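(* For any $n,r\in\mathbb{N}$, if $G$ is an $n$-vertex, $r$-regular graph with $r\geq 1$, then $G$ satisfies \[ i_t(G)\leq [x^t]\left(2(1+x)^r-1\right)^{\frac{n}{2r}} \] for all $t\leq 3$, and for $t=4$ when $G$ is assumed triangle-free, with equality holding if and only if $2r$ divides $n$ and $G=\frac{n}{2r}K_{r,r}$.
   Context: All graphs are simple. For a graph $G$ and a nonnegative integer $t$, $i_t(G)$ denotes the number of independent sets of $G$ of size $t$. For a power series $P(x)$, $[x^t]P(x)$ denotes the coefficient of $x^t$ in $P(x)$; the expression $(2(1+x)^r-1)^{n/(2r)}$ is understood as the power series given by its Taylor expansion about $x=0$. $K_{r,r}$ is the complete bipartite graph with both parts of size $r$, and $kH$ denotes the disjoint union of $k$ copies of a graph $H$ (graph equality is up to isomorphism). *)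

(* Defs.v *)
From HB Require Import structures.
From mathcomp Require Import all_boot all_order all_algebra.
From mathcomp Require Import all_classical all_reals all_analysis.
Set Implicit Arguments.
Unset Strict Implicit.
Unset Printing Implicit Defensive.
Import Order.TTheory GRing.Theory Num.Theory.
Import numFieldNormedType.Exports.

Local Open Scope ring_scope.

Record sgraph := SGraph {
  vertex :> finType;
  edge : rel vertex;
  edge_sym : symmetric edge;
  edge_irrefl : irreflexive edge }.

Definition regular_graph (r : nat) (G : sgraph) : Prop :=
  forall x : G, #|[set y : G | edge x y]| = r.

Definition triangle_free (G : sgraph) : Prop :=
  forall x y z : G, ~~ [&& edge x y, edge y z & edge x z].

Definition independent (G : sgraph) (A : {set G}) : bool :=
  [forall x in A, forall y in A, ~~ edge x y].

Definition num_indep (t : nat) (G : sgraph) : nat :=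
  #|[set A : {set G} | independent A & #|A| == t]|.

Definition graph_iso (G H : sgraph) : Prop :=
  exists2 f : G -> H, bijective f & forall x y : G, edge (f x) (f y) = edge x y.

Definition complete_bip_edge (r : nat) : rel ('I_r + 'I_r)%type :=
  fun x y =>
    match x, y with
    | inl _, inr _ | inr _, inl _ => true
    | _, _ => false
    end.

Lemma complete_bip_sym (r : nat) : symmetric (@complete_bip_edge r).
Proof. by case=> i [] j. Qed.

Lemma complete_bip_irrefl (r : nat) : irreflexive (@complete_bip_edge r).
Proof. by case. Qed.

Definition complete_bip (r : nat) : sgraph :=
  SGraph (@complete_bip_sym r) (@complete_bip_irrefl r).

Definition copies_edge (k : nat) (H : sgraph) : rel ('I_k * H)%type :=
  fun x y => (x.1 == y.1) && edge x.2 y.2.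

Lemma copies_sym (k : nat) (H : sgraph) : symmetric (@copies_edge k H).
Proof. by move=> x y; rewrite /copies_edge eq_sym edge_sym. Qed.

Lemma copies_irrefl (k : nat) (H : sgraph) : irreflexive (@copies_edge k H).
Proof. by move=> x; rewrite /copies_edge edge_irrefl andbF. Qed.

Definition copies (k : nat) (H : sgraph) : sgraph :=
  SGraph (@copies_sym k H) (@copies_irrefl k H).

(* Meaningful only for f that is t times differentiable at 0, since derive1n is
   total; (2 (1 + x)^r - 1)^a is smooth near 0, its base being 1 there. *)
Definition taylor_coef (R : realType) (t : nat) (f : R -> R) : R :=
  (derive1n t f) 0 / t`!%:R.

(* Main.v *)
Require Import Defs.
From mathcomp Require Import all_boot all_order all_algebra.
From mathcomp Require Import all_classical all_reals all_analysis.
From mathcomp Require Import ring zify fintype finset.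
Import Order.TTheory GRing.Theory Num.Theory.
Import numFieldNormedType.Exports.
Set Implicit Arguments.
Unset Strict Implicit.
Unset Printing Implicit Defensive.
Local Open Scope ring_scope.

(** Counting ordered instead of unordered independent sets, [t`! * i_t(G)] is
    obtained by choosing vertices one after the other, each outside the closed
    neighbourhoods of the previous ones. Pairwise non-adjacent distinct vertices
    have closed neighbourhoods that meet only in common neighbours, so by
    inclusion-exclusion the number of choices for the next vertex depends only
    on [n], [r] and numbers of common neighbours. Write [codeg x y] for the
    number of common neighbours of [x] and [y].

    For [t <= 2] this determines [i_t]. For [t = 3] it gives
    [6 i_3 = n(n-r-1)(n-2r-2) + D], where [D], the sum of [codeg x y] over
    non-adjacent pairs of distinct vertices, is at most [n r (r-1)], with
    equality when there are no triangles ([num_indep3_regular],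
    [apart_codeg_le], [apart_codeg_tf]). For [t = 4] and [G] triangle-free,
    everything is again determined by [n] and [r] except for
    [S], the sum of [(codeg x y)^2] over all ordered pairs, that is, the number
    of homomorphisms from a 4-cycle to [G]; it enters with coefficient 3
    ([num_indep4_regular]).

    As [codeg x y <= r] and the [codeg x y] sum up to [n r^2], one has
    [S <= n r^3], with equality exactly when [codeg x y] is always [0] or [r],
    that is, when two vertices with a common neighbour have the same
    neighbourhood ([c4_homs_leqif], [c4_homs_maxP]). For a triangle-free
    [r]-regular graph this says that every component is a [K_{r,r}]
    ([graph_iso_copies_of_twins], [twins_of_graph_iso]).

    It remains to see that the Taylor coefficients are the values of these
    formulas at the extremal [D] and [S]. The first four derivatives of
    [g^a] at [0], where [g = 2(1+x)^r - 1], are computed from the values of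
    the derivatives of [g] there, namely twice the falling factorials of [r];
    with [a = n/(2r)] they become polynomials in [n] and [r]
    ([taylor_coef_extremal]). *)

(** * Derivatives of real powers of a polynomial *)

Section PowerDerivatives.
Context {R : realType}.
Implicit Types (g : {poly R}) (a x : R) (t k r : nat).

(** The [t]-th derivative of [g^a] is a polynomial times [g^(a-t)]; the
    recursion is the product rule with one factor [g] pulled out. *)
Fixpoint pow_deriv_num a g t : {poly R} :=
  if t is s.+1 then
    (pow_deriv_num a g s)^`() * g + (a - s%:R)%:P * pow_deriv_num a g s * g^`()
  else 1.

(** Positivity at the single point [x] is enough because it spreads to a
    neighbourhood, on which the induction hypothesis identifies the previous
    derivative. *)
Lemma derive1n_horner_powR a g t x : 0 < g.[x] ->
  derive1n t (fun y => g.[y] `^ a) x =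
  (pow_deriv_num a g t).[x] * g.[x] `^ (a - t%:R).
Proof.
elim: t x => [|t IHt] x gx; first by rewrite /= hornerC mul1r subr0.
rewrite derive1nS derive1E.
have near_gt0 : \forall y \near x, 0 < g.[y].
  exact: (cvgr_gt _ (@continuous_horner _ g x)) gx.
rewrite (near_eq_derive
  (g := fun y => (pow_deriv_num a g t).[y] * g.[y] `^ (a - t%:R))); last first.
  by near=> y; apply: IHt; near: y.
have dpow : is_derive x 1 (fun y => g.[y] `^ (a - t%:R))
    (((a - t%:R) * g.[x] `^ (a - t%:R - 1)) * g^`().[x]).
  apply: (is_derive1_comp (f := fun y => y `^ (a - t%:R)) (g := horner g)).
  exact: is_derive1_powR.
have -> := @derive_val _ _ _ _ _ _ _ (is_deriveM (is_derive_poly _ _) dpow).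
rewrite /GRing.scale /= !(hornerD, hornerM, hornerC) -[t.+1]addn1 natrD opprD addrA.
have -> : g.[x] `^ (a - t%:R) = g.[x] * g.[x] `^ (a - t%:R - 1).
  rewrite -{2}(@powRr1 _ g.[x]) ?ltW// -powRD; last by rewrite (gt_eqF gx) implybT.
  by congr (_ `^ _); ring.
ring.
Unshelve. all: by end_near.
Qed.

Lemma derivn_1DX_exp r k :
  ((1 + 'X) ^+ r : {poly R})^`(k) = (1 + 'X) ^+ (r - k) *+ r ^_ k.
Proof.
elim: k => [|k IHk]; first by rewrite derivn0 subn0.
rewrite derivnS IHk derivMn deriv_exp derivD derivC derivX add0r mul1r.
by rewrite -mulrnA mulnC ffactnSr subnS.
Qed.

Definition base_poly r : {poly R} := 2%:P * (1 + 'X) ^+ r - 1.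

Lemma base_poly_derivn0 r k : (base_poly r)^`(k.+1).[0] = 2 * (r ^_ k.+1)%:R.
Proof.
rewrite derivnB mul_polyC derivnZ derivn_1DX_exp derivnC subr0.
by rewrite hornerZ hornerMn !hornerE expr1n.
Qed.

(** Since [g] is [1] at [0], the remaining power of [g] disappears there and
    the coefficient becomes purely algebraic. *)
Lemma taylor_coef_base_powR r a t :
  taylor_coef t (fun x => (2 * (1 + x) ^+ r - 1) `^ a) * t`!%:R =
  (pow_deriv_num a (base_poly r) t).[0].
Proof.
have baseE x : (base_poly r).[x] = 2 * (1 + x) ^+ r - 1.
  by rewrite /base_poly !hornerE.
have base0 : (base_poly r).[0] = 1 by rewrite baseE addr0 expr1n; ring.
rewrite /taylor_coef divfK ?pnatr_eq0 -?lt0n ?fact_gt0//.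
under [fun x => _]funext do rewrite -baseE.
by rewrite derive1n_horner_powR base0 ?ltr01// powR1 mulr1.
Qed.

(** Powers are written as products, so that the Leibniz rule alone
    differentiates each formula into the next one. *)
Lemma pow_deriv_numE a g (A := a%:P : {poly R}) (g1 := g^`()) (g2 := g1^`())
    (g3 := g2^`()) (g4 := g3^`()) :
  [/\ pow_deriv_num a g 1 = A * g1,
      pow_deriv_num a g 2 = A * (g2 * g + (A - 1) * (g1 * g1)),
      pow_deriv_num a g 3 = A * (g3 * (g * g)
        + 3%:R * (A - 1) * (g1 * g2 * g)
        + (A - 1) * (A - 2%:R) * (g1 * g1 * g1)) &
      pow_deriv_num a g 4 = A * (g4 * (g * g * g)
        + (A - 1) * ((4%:R * (g1 * g3) + 3%:R * (g2 * g2)) * (g * g))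
        + 6%:R * (A - 1) * (A - 2%:R) * (g1 * g1 * g2 * g)
        + (A - 1) * (A - 2%:R) * (A - 3%:R) * (g1 * g1 * g1 * g1))].
Proof.
have dA : A^`() = 0 by rewrite derivC.
have dn k : (k%:R : {poly R})^`() = 0 by rewrite -polyC_natr derivC.
have d1 : (1 : {poly R})^`() = 0 by rewrite derivC.
have numS t : pow_deriv_num a g t.+1 =
  (pow_deriv_num a g t)^`() * g + (A - t%:R) * pow_deriv_num a g t * g1.
  by rewrite /= polyCB polyC_natr.
have E1 : pow_deriv_num a g 1 = A * g1.
  by rewrite numS /= d1 subr0 mul0r add0r mulr1.
have E2 : pow_deriv_num a g 2 = A * (g2 * g + (A - 1) * (g1 * g1)).
  by rewrite numS E1 derivM dA -/g1 -/g2; ring.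
have E3 : pow_deriv_num a g 3 = A * (g3 * (g * g) + 3%:R * (A - 1) * (g1 * g2 * g)
        + (A - 1) * (A - 2%:R) * (g1 * g1 * g1)).
  by rewrite numS E2 !(derivM, derivD, derivN, dA, d1, dn) -/g1 -/g2 -/g3; ring.
split=> //.
by rewrite numS E3 !(derivM, derivD, derivN, dA, d1, dn) -/g1 -/g2 -/g3 -/g4; ring.
Qed.

Lemma pow_deriv_num4 a g (g0 := g.[0]) (g1 := g^`(1).[0]) (g2 := g^`(2).[0])
    (g3 := g^`(3).[0]) (g4 := g^`(4).[0]) : g0 = 1 ->
  [/\ (pow_deriv_num a g 1).[0] = a * g1,
      (pow_deriv_num a g 2).[0] = a * g2 + a * (a - 1) * g1 ^+ 2,
      (pow_deriv_num a g 3).[0] = a * g3 + 3 * a * (a - 1) * g1 * g2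
        + a * (a - 1) * (a - 2) * g1 ^+ 3 &
      (pow_deriv_num a g 4).[0] = a * g4
        + a * (a - 1) * (4 * g1 * g3 + 3 * g2 ^+ 2)
        + 6 * a * (a - 1) * (a - 2) * g1 ^+ 2 * g2
        + a * (a - 1) * (a - 2) * (a - 3) * g1 ^+ 4].
Proof.
rewrite /g0 /g1 /g2 /g3 /g4 !derivnS derivn0 => gx.
have [-> -> -> ->] := pow_deriv_numE a g.
split; rewrite -?polyC_natr ?(hornerM, hornerD, hornerN, hornerC) ?gx; ring.
Qed.

End PowerDerivatives.

(** * Independent sets counted in order *)

Section OrderedCount.
Context {G : sgraph}.
Implicit Types (x y z u v w : G) (A B C : {set G}) (k t : nat).

(** Adjacency in the complement graph. *)
Definition apart x y := (x != y) && ~~ edge x y.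

Lemma apart_sym x y : apart x y = apart y x.
Proof. by rewrite /apart eq_sym edge_sym. Qed.

Definition free_from A v := [forall u in A, apart u v].

Lemma free_fromU1 v A w : free_from (v |: A) w = apart v w && free_from A w.
Proof.
apply/forall_inP/andP => [h | [hv /forall_inP hA] u].
  split; first by apply: h; rewrite setU11.
  by apply/forall_inP => u uA; apply: h; rewrite setU1r.
by rewrite in_setU1 => /predU1P[-> | /hA].
Qed.

Lemma free_from0 w : free_from set0 w.
Proof. by apply/forall_inP => u; rewrite inE. Qed.

Lemma free_from_notin A v : free_from A v -> v \notin A.
Proof. by move=> /forall_inP h; apply/negP => /h; rewrite /apart eqxx. Qed.

Lemma independentU1 v A : independent A -> free_from A v ->
  independent (v |: A).
Proof.
move=> /forall_inP iA /forall_inP fA; apply/forall_inP => x xU.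
apply/forall_inP => y yU; case/setU1P: xU yU => [-> | xA] /setU1P[-> | yA].
- by rewrite edge_irrefl.
- by rewrite edge_sym; case/andP: (fA _ yA).
- by case/andP: (fA _ xA).
- exact: (forall_inP (iA _ xA)).
Qed.

Fixpoint num_ext k A : nat :=
  if k is j.+1 then (\sum_(v | free_from A v) num_ext j (v |: A))%N else 1.

Definition indep_above k A :=
  [set B : {set G} | [&& A \subset B, independent B & #|B| == (#|A| + k)%N]].

(** Pull out the first chosen vertex [v]: a set [B] above [A] with [k.+1] new
    elements is reached once for each [v] in [B :\: A], which turns [k`!] into
    [k.+1`!]. *)
Lemma num_extE k A : independent A ->
  num_ext k A = (k`! * #|indep_above k A|)%N.
Proof.
elim: k A => [|k IHk] A iA /=.
  (* Nothing left to choose: only [A] itself lies above [A]. *)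
  suff -> : indep_above 0 A = [set A] by rewrite cards1.
  apply/setP => B; rewrite !inE addn0; apply/and3P/eqP => [[AB _ cB] | ->].
    by apply/esym/eqP; rewrite eqEcard AB (eqP cB) leqnn.
  by [].
transitivity (\sum_(v | free_from A v) \sum_(B in indep_above k.+1 A | v \in B) k`!)%N.
  apply: eq_bigr => v fv; rewrite IHk ?independentU1// mulnC -sum_nat_const.
  apply: eq_bigl => B; rewrite !inE subUset sub1set cardsU1.
  rewrite (free_from_notin fv) add1n addSnnS.
  by case: (v \in B); rewrite ?andbT ?andbF.
rewrite (exchange_big_dep (mem (indep_above k.+1 A))) //= => [|v B _ /andP[]//].
rewrite mulnC -sum_nat_const; apply: eq_bigr => B.
rewrite inE => /and3P[AB iB /eqP cB].
rewrite sum_nat_cond_const factS; congr (_ * _)%N.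
have cD : #|B :\: A| = k.+1 by rewrite cardsD (setIidPr AB) cB addKn.
rewrite -[RHS]cD.
apply: eq_card => v; rewrite [LHS]in_set AB iB cB eqxx in_setD /=.
case vB: (v \in B) => /=; rewrite ?andbF ?andbT//.
apply/idP/idP => [|vA]; first exact: free_from_notin.
apply/forall_inP => u uA; rewrite /apart (forall_inP (forall_inP iB _ _))//.
  by rewrite andbT; apply: contraNneq vA => <-.
exact: (fintype.subsetP AB).
Qed.

Lemma num_ext_num_indep t : num_ext t set0 = (t`! * num_indep t G)%N.
Proof.
rewrite num_extE; last by apply/forall_inP => x; rewrite inE.
congr (_ * _)%N; apply: eq_card => A.
by rewrite !inE sub0set cards0.
Qed.

Lemma num_indep0 : num_indep 0 G = 1%N.
Proof. by have := num_ext_num_indep 0; rewrite fact0 mul1n. Qed.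

Lemma num_indep1 : num_indep 1 G = #|G|.
Proof.
have := num_ext_num_indep 1; rewrite -[1`!]/1%N mul1n => <- /=.
by rewrite -sum1_card; apply: eq_bigl => x; rewrite free_from0.
Qed.

Definition apart_set x := [set y | apart x y].

Lemma num_indep2 : (2 * num_indep 2 G)%N = (\sum_x #|apart_set x|)%N.
Proof.
rewrite -[2%N]/(2`!) -num_ext_num_indep /=.
apply: eq_big => [x|x _]; first by rewrite free_from0.
by rewrite -sum1_card; apply: eq_bigl => y; rewrite free_fromU1 free_from0 !inE andbT.
Qed.

Lemma num_indep3 : (6 * num_indep 3 G)%N =
  (\sum_x \sum_(y | apart x y) #|apart_set x :&: apart_set y|)%N.
Proof.
rewrite -[6%N]/(3`!) -num_ext_num_indep /=.
apply: eq_big => [x|x _]; first by rewrite free_from0.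
apply: eq_big => [y|y _]; first by rewrite free_fromU1 free_from0 andbT.
rewrite -sum1_card; apply: eq_bigl => z.
by rewrite !free_fromU1 free_from0 !inE andbT andbC.
Qed.

Lemma num_indep4 : (24 * num_indep 4 G)%N =
  (\sum_x \sum_(y | apart x y) \sum_(z | apart x z && apart y z)
     #|apart_set x :&: apart_set y :&: apart_set z|)%N.
Proof.
rewrite -[24%N]/(4`!) -num_ext_num_indep /=.
apply: eq_big => [x|x _]; first by rewrite free_from0.
apply: eq_big => [y|y _]; first by rewrite free_fromU1 free_from0 andbT.
apply: eq_big => [z|z _]; first by rewrite !free_fromU1 free_from0 andbT andbC.
rewrite -sum1_card; apply: eq_bigl => w.
by rewrite !free_fromU1 free_from0 !inE andbT andbC (andbC (apart y w)).
Qed.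

End OrderedCount.

(** * Numbers of common neighbours *)

Section CommonNeighbours.
Context {G : sgraph}.
Implicit Types (x y z w : G).

Definition nbhd x := [set y | edge x y].
Definition codeg x y := #|nbhd x :&: nbhd y|.

Lemma codegE x y : codeg x y = (\sum_(z | edge x z) edge z y)%N.
Proof.
rewrite /codeg -sum1_card big_mkcond [RHS]big_mkcond; apply: eq_bigr => z _ /=.
by rewrite !inE (edge_sym z); case: (edge x z); case: (edge y z).
Qed.

Lemma sum_by_adjacency (K : nmodType) (F : G -> K) x :
  \sum_y F y = F x + \sum_(y | edge x y) F y + \sum_(y | apart x y) F y.
Proof.
rewrite (bigD1 x)//= (bigID (edge x))/= addrA; congr (_ + _ + _).
  by apply: eq_bigl => y; case: eqVneq => [->|]; rewrite ?edge_irrefl.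
by apply: eq_bigl => y; rewrite /apart eq_sym.
Qed.

Lemma apart_setE x : apart_set x = ~: (x |: nbhd x).
Proof. by apply/setP => y; rewrite !inE negb_or eq_sym. Qed.

(** The centres drop out of the intersection because neither belongs to the
    closed neighbourhood of the other. *)
Lemma closed_nbhdI x y : apart x y ->
  (x |: nbhd x) :&: (y |: nbhd y) = nbhd x :&: nbhd y.
Proof.
case/andP=> xy nxy; apply/setP => w; rewrite !inE.
case: eqVneq => [->|wx] /=; first by rewrite (negbTE xy) edge_irrefl edge_sym (negbTE nxy).
by case: eqVneq => [->|//]; rewrite edge_irrefl (negbTE nxy).
Qed.

Section Regular.
Context {r : nat}.
Context (G_reg : regular_graph r G).

Lemma card_nbhd x : #|nbhd x| = r. Proof. exact: G_reg. Qed.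

Lemma codeg_le x y : (codeg x y <= r)%N.
Proof. by rewrite -(card_nbhd x) subset_leq_card // subsetIl. Qed.

Lemma codeg_diag x : codeg x x = r.
Proof. by rewrite /codeg setIid card_nbhd. Qed.

(** Both sides count walks of length two from [x]. *)
Lemma sum_codeg x : (\sum_y codeg x y = r * r)%N.
Proof.
under eq_bigr do rewrite codegE.
rewrite exchange_big /= -{1}(card_nbhd x) -sum_nat_const.
rewrite [RHS](eq_bigl (edge x)); last by move=> z; rewrite inE.
apply: eq_bigr => z _; rewrite -(card_nbhd z) -sum1_card [RHS]big_mkcond.
by apply: eq_bigr => y _; rewrite inE; case: edge.
Qed.

Section Ring.
Context {K : numDomainType}.
Let n : K := #|G|%:R.
Let rr : K := r%:R.

Lemma card_closed_nbhd x : #|x |: nbhd x| = r.+1.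
Proof. by rewrite cardsU1 inE edge_irrefl card_nbhd. Qed.

Lemma natr_cardsC (A : {set G}) : #|~: A|%:R = n - #|A|%:R.
Proof. by rewrite /n -(cardsC A) natrD addrC addKr. Qed.

Lemma card_apart x : #|apart_set x|%:R = n - rr - 1.
Proof. by rewrite apart_setE natr_cardsC card_closed_nbhd -addn1 natrD opprD addrA. Qed.

(** Inclusion-exclusion for the two closed neighbourhoods. *)
Lemma card_apart2 x y : apart x y ->
  #|apart_set x :&: apart_set y|%:R = n - 2 * (rr + 1) + (codeg x y)%:R.
Proof.
move=> xy; rewrite !apart_setE -setCU natr_cardsC.
have := cardsUI (x |: nbhd x) (y |: nbhd y).
rewrite closed_nbhdI// !card_closed_nbhd -/(codeg x y) => /(congr1 (fun k => k%:R : K)).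
by rewrite !natrD -addn1 natrD -/rr => e; rewrite -[#|_|%:R in LHS](addrK (codeg x y)%:R) e; ring.
Qed.

Definition codeg3 x y z := #|nbhd x :&: nbhd y :&: nbhd z|.

(** Inclusion-exclusion for the three closed neighbourhoods. *)
Lemma card_apart3 x y z : apart x y -> apart x z -> apart y z ->
  #|apart_set x :&: apart_set y :&: apart_set z|%:R =
  n - 3 * (rr + 1) + (codeg x y)%:R + (codeg x z)%:R + (codeg y z)%:R
  - (codeg3 x y z)%:R.
Proof.
move=> xy xz yz; rewrite !apart_setE -!setCU natr_cardsC.
set X := x |: _; set Y := y |: _; set Z := z |: _.
have e1 := cardsUI (X :|: Y) Z; have e2 := cardsUI X Y.
have e3 := cardsUI (X :&: Z) (Y :&: Z).
have t3 : X :&: Z :&: (Y :&: Z) = nbhd x :&: nbhd y :&: nbhd z.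
  rewrite closed_nbhdI// closed_nbhdI//; apply/setP => w; rewrite !inE.
  by case: (edge x w); case: (edge y w); case: (edge z w).
rewrite t3 !closed_nbhdI// in e3; rewrite setIUl !closed_nbhdI// in e1.
rewrite closed_nbhdI// in e2; rewrite !card_closed_nbhd in e1 e2.
rewrite -/(codeg x y) in e2; rewrite -/(codeg x z) -/(codeg y z) -/(codeg3 x y z) in e3.
have {e1 e2 e3} : (#|X :|: Y :|: Z| + codeg x y + codeg x z + codeg y z
   = r + r + r + 3 + codeg3 x y z)%N by lia.
move=> /(congr1 (fun k => k%:R : K)); rewrite !natrD -/rr => e.
have -> : #|X :|: Y :|: Z|%:R = rr + rr + rr + 3 + (codeg3 x y z)%:R
  - (codeg y z)%:R - (codeg x z)%:R - (codeg x y)%:R :> K.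
  by rewrite -e; ring.
ring.
Qed.

Lemma sum_const_apart x (c : K) : \sum_(y | apart x y) c = (n - rr - 1) * c.
Proof.
rewrite -(card_apart x) mulr_natl -sumr_const.
by apply: eq_bigl => y; rewrite inE.
Qed.

Lemma num_indep2_regular : 2 * (num_indep 2 G)%:R = n * (n - rr - 1).
Proof.
have /(congr1 (fun k => k%:R : K)) := @num_indep2 G.
rewrite natrM => ->; rewrite natr_sum.
under eq_bigr do rewrite card_apart.
by rewrite sumr_const -[LHS]mulr_natl.
Qed.

Definition apart_codeg : K := \sum_x \sum_(y | apart x y) (codeg x y)%:R.

Lemma num_indep3_regular :
  6 * (num_indep 3 G)%:R =
  n * (n - rr - 1) * (n - 2 * (rr + 1)) + apart_codeg.
Proof.
have /(congr1 (fun k => k%:R : K)) := @num_indep3 G.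
rewrite natrM => ->; rewrite natr_sum /apart_codeg.
have -> : n * (n - rr - 1) * (n - 2 * (rr + 1)) =
   \sum_(x : G) \sum_(y | apart x y) (n - 2 * (rr + 1)).
  under eq_bigr do rewrite sum_const_apart.
  by rewrite sumr_const -[RHS]mulr_natl mulrA.
rewrite -big_split; apply: eq_bigr => x _.
rewrite natr_sum -big_split; apply: eq_bigr => y xy /=.
exact: card_apart2.
Qed.

Lemma sum_apart_codeg x :
  \sum_(y | apart x y) (codeg x y)%:R =
  rr * (rr - 1) - \sum_(y | edge x y) (codeg x y)%:R.
Proof.
have := sum_by_adjacency (fun y => (codeg x y)%:R : K) x.
rewrite -natr_sum sum_codeg codeg_diag natrM -/rr => e.
have -> : rr * (rr - 1) = rr * rr - rr by ring.
by rewrite e; ring.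
Qed.

(** Each vertex [x] starts [r (r-1)] walks of length two that do not return to
    [x]; those ending at a neighbour of [x] close a triangle and are lost. *)
Lemma apart_codeg_le : apart_codeg <= n * (rr * (rr - 1)).
Proof.
rewrite /n mulr_natl -sumr_const; apply: ler_sum => x _.
by rewrite sum_apart_codeg lerBlDr lerDl sumr_ge0.
Qed.

Section TriangleFree.
Context (G_tf : triangle_free G).

Lemma codeg_adjacent x y : edge x y -> codeg x y = 0%N.
Proof.
move=> xy; apply/eqP; rewrite cards_eq0; apply/eqP/setP => z.
rewrite !inE; apply/negbTE/negP => /andP[xz yz].
by have := G_tf x y z; rewrite xy yz xz.
Qed.

Lemma sum_apart_codeg_tf x :
  \sum_(y | apart x y) (codeg x y)%:R = rr * (rr - 1).
Proof.
by rewrite sum_apart_codeg big1 ?subr0// => y /codeg_adjacent ->.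
Qed.

Lemma apart_codeg_tf : apart_codeg = n * (rr * (rr - 1)).
Proof.
rewrite /apart_codeg; under eq_bigr do rewrite sum_apart_codeg_tf.
by rewrite sumr_const -[LHS]mulr_natl.
Qed.

(** Without triangles, any two distinct neighbours of a vertex may occur
    together in an independent set. *)
Lemma apart_siblings w x y : edge w x -> edge w y -> apart x y = (x != y).
Proof.
move=> wx wy; rewrite /apart; case: (x != y) => //=.
by have := G_tf w x y; rewrite wx wy andbT.
Qed.

(** A homomorphism from a 4-cycle is a pair of opposite vertices together with
    two of their common neighbours, chosen independently. *)
Definition c4_homs : nat := (\sum_(x : G) \sum_(y : G) codeg x y ^ 2)%N.

Lemma sum_apart_codeg2 x :
  \sum_(y | apart x y) (codeg x y)%:R ^+ 2 =
  \sum_y (codeg x y)%:R ^+ 2 - rr ^+ 2 :> K.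
Proof.
rewrite (sum_by_adjacency _ x) codeg_diag (big1 _ (edge x)).
  by rewrite addr0 addrAC subrr add0r.
by move=> y /codeg_adjacent ->; rewrite expr0n.
Qed.

(** Exchange the summations: for a common neighbour [w] of [x] and [y], the
    admissible [z] are the other [r - 2] neighbours of [w]. *)
Lemma sum_codeg3 x y : apart x y ->
  \sum_(z | apart x z && apart y z) (codeg3 x y z)%:R =
  (codeg x y)%:R * (rr - 2) :> K.
Proof.
move=> xy; have [nxy _] := andP xy.
have -> : (codeg x y)%:R * (rr - 2) =
  \sum_(w in nbhd x :&: nbhd y) (#|nbhd w :\: [set x; y]|%:R : K).
  rewrite mulr_natl -sumr_const; apply: eq_bigr => w.
  rewrite !inE !(edge_sym _ w) => /andP[wx wy].
  have sub : [set x; y] \subset nbhd w.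
    by apply/subsetP => u; rewrite !inE => /orP[] /eqP->.
  rewrite cardsD (setIidPr sub) cards2 nxy card_nbhd natrB//.
  by rewrite -(card_nbhd w) (leq_trans _ (subset_leq_card sub)) ?cards2 ?nxy.
rewrite -!natr_sum; congr (_%:R).
transitivity (\sum_(z | apart x z && apart y z)
   \sum_(w in nbhd x :&: nbhd y | edge w z) 1)%N.
  apply: eq_bigr => z _; rewrite /codeg3 -sum1_card; apply: eq_bigl => w.
  by rewrite !inE (edge_sym z).
rewrite (exchange_big_dep (mem (nbhd x :&: nbhd y)))/= => [|z w _ /andP[]//].
apply: eq_bigr => w; rewrite !inE !(edge_sym _ w) => /andP[wx wy].
rewrite -sum1_card; apply: eq_bigl => z; rewrite !inE wx wy /=.
case wz: (edge w z); rewrite ?andbF// !andbT.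
by rewrite !(@apart_siblings w)// negb_or !(eq_sym z).
Qed.

(** Sums over ordered independent triples, which are invariant under permuting
    the arguments of the summand; this identifies the contributions of the
    three pairs in [card_apart3]. *)
Definition apart_triple_sum (F : G -> G -> G -> K) : K :=
  \sum_x \sum_(y | apart x y) \sum_(z | apart x z && apart y z) F x y z.

Lemma apart_triple_sumE F : apart_triple_sum F =
  \sum_x \sum_y \sum_z
    (if [&& apart x y, apart x z & apart y z] then F x y z else 0).
Proof.
apply: eq_bigr => x _; rewrite big_mkcond; apply: eq_bigr => y _.
by case: ifP => xy; rewrite ?big_mkcond// big1.
Qed.

Lemma apart_triple_sum_swap23 F :
  apart_triple_sum F = apart_triple_sum (fun x y z => F x z y).
Proof.
rewrite !apart_triple_sumE; apply: eq_bigr => x _; rewrite exchange_big.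
apply: eq_bigr => y _; apply: eq_bigr => z _.
by rewrite (apart_sym z y) andbCA.
Qed.

Lemma apart_triple_sum_swap12 F :
  apart_triple_sum F = apart_triple_sum (fun x y z => F y x z).
Proof.
rewrite !apart_triple_sumE exchange_big; apply: eq_bigr => x _.
apply: eq_bigr => y _; apply: eq_bigr => z _.
by rewrite (apart_sym y x) (andbC (apart y z)).
Qed.

Lemma apart_triple_sum_fst2 (F : G -> G -> K) :
  apart_triple_sum (fun x y _ => F x y) =
  \sum_x \sum_(y | apart x y) #|apart_set x :&: apart_set y|%:R * F x y.
Proof.
apply: eq_bigr => x _; apply: eq_bigr => y _.
by rewrite mulr_natl -sumr_const; apply: eq_bigl => z; rewrite !inE.
Qed.

(** Extending a pair to a triple multiplies its weight [codeg x y] by an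
    expression affine in [codeg x y] ([card_apart2]); this is where the squares
    in [c4_homs] come from. *)
Lemma apart_triple_sum_codeg :
  apart_triple_sum (fun x y _ => (codeg x y)%:R) =
  (n - 2 * (rr + 1)) * (n * (rr * (rr - 1))) + c4_homs%:R - n * rr ^+ 2.
Proof.
have -> : n * rr ^+ 2 = \sum_(x : G) rr ^+ 2.
  by rewrite sumr_const -[RHS]mulr_natl.
rewrite apart_triple_sum_fst2 -apart_codeg_tf /apart_codeg mulr_sumr.
rewrite natr_sum -addrA -sumrB -big_split; apply: eq_bigr => x _ /=.
have -> : (\sum_y codeg x y ^ 2)%:R = \sum_y (codeg x y)%:R ^+ 2 :> K.
  by rewrite natr_sum; apply: eq_bigr => y _; rewrite natrX.
rewrite -sum_apart_codeg2 mulr_sumr -big_split; apply: eq_bigr => y xy /=.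
by rewrite card_apart2//; ring.
Qed.

(** Sum [card_apart3] over all ordered independent triples. *)
Lemma num_indep4_regular :
  24 * (num_indep 4 G)%:R =
  (n - 3 * (rr + 1)) * (6 * (num_indep 3 G)%:R)
  + 3 * ((n - 2 * (rr + 1)) * (n * (rr * (rr - 1)))
         + c4_homs%:R - n * rr ^+ 2)
  - n * (rr * (rr - 1)) * (rr - 2).
Proof.
have i3 : 6 * (num_indep 3 G)%:R = apart_triple_sum (fun _ _ _ => 1).
  have /(congr1 (fun k => k%:R : K)) := @num_indep3 G.
  rewrite natrM => ->; rewrite natr_sum (apart_triple_sum_fst2 (fun _ _ => 1)).
  by apply: eq_bigr => x _; rewrite natr_sum; under [RHS]eq_bigr do rewrite mulr1.
have c3 : apart_triple_sum (fun x y z => (codeg3 x y z)%:R) =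
    n * (rr * (rr - 1)) * (rr - 2).
  rewrite -apart_codeg_tf /apart_codeg mulr_suml; apply: eq_bigr => x _.
  by rewrite mulr_suml; apply: eq_bigr => y xy; rewrite sum_codeg3.
have cxz : apart_triple_sum (fun x _ z => (codeg x z)%:R) =
    apart_triple_sum (fun x y _ => (codeg x y)%:R).
  exact: apart_triple_sum_swap23.
have cyz : apart_triple_sum (fun _ y z => (codeg y z)%:R) =
    apart_triple_sum (fun x y _ => (codeg x y)%:R).
  by rewrite apart_triple_sum_swap12.
rewrite i3 -c3 -apart_triple_sum_codeg.
have -> (a b c d : K) : a * b + 3 * c - d = a * b + c + c + c - d by ring.
rewrite -{2}cxz -{2}cyz.
have /(congr1 (fun k => k%:R : K)) := @num_indep4 G.
rewrite natrM => ->; rewrite natr_sum /apart_triple_sum mulr_sumr.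
rewrite -!big_split -sumrB; apply: eq_bigr => x _ /=.
rewrite natr_sum mulr_sumr -!big_split -sumrB; apply: eq_bigr => y xy /=.
rewrite natr_sum mulr_sumr -!big_split -sumrB; apply: eq_bigr => z /andP[xz yz] /=.
by rewrite card_apart3// mulr1.
Qed.

End TriangleFree.
End Ring.
End Regular.
End CommonNeighbours.

(** * The extremal graphs *)

Section Extremal.
Context {G : sgraph}.
Implicit Types (x y z u v w : G).

Definition twins_if_common_nbr := forall x y z : G,
  edge x z -> edge y z -> nbhd x = nbhd y.

Lemma codeg_gt0P x y :
  reflect (exists2 z, edge x z & edge y z) (0 < codeg x y)%N.
Proof.
apply: (iffP card_gt0P) => [[z]|[z xz yz]]; last by exists z; rewrite !inE xz.
by rewrite !inE => /andP[]; exists z.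
Qed.

Section Regular.
Context {r : nat} (G_reg : regular_graph r G).

Lemma codeg_eq_r x y : (codeg x y == r) = (nbhd x == nbhd y).
Proof.
apply/eqP/eqP => [cxy | e]; last by rewrite /codeg -e setIid (card_nbhd G_reg).
apply/eqP; rewrite eqEcard !(card_nbhd G_reg) leqnn andbT.
apply/setIidPl/eqP; rewrite eqEcard subsetIl (card_nbhd G_reg).
by rewrite -/(codeg x y) cxy leqnn.
Qed.

(** [codeg x y ^ 2 <= r * codeg x y] term by term, and the right-hand sides add
    up to [n r^3] because the codegrees from a vertex sum to [r^2]. *)
Lemma c4_homs_leqif :
  (c4_homs (G := G) <= #|G| * r ^ 3
     ?= iff [forall x : G, forall y : G, (codeg x y == 0) || (codeg x y == r)])%N.
Proof.
have -> : (#|G| * r ^ 3 = \sum_(x : G) \sum_(y : G) r * codeg x y)%N.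
  under eq_bigr do rewrite -big_distrr /= (sum_codeg G_reg).
  by rewrite sum_nat_const.
apply: leqif_sum => x _; apply: leqif_sum => y _; split.
  by rewrite -mulnn leq_mul2r (codeg_le G_reg) orbT.
by rewrite -mulnn eqn_mul2r.
Qed.

Lemma c4_homs_maxP : c4_homs (G := G) = (#|G| * r ^ 3)%N <-> twins_if_common_nbr.
Proof.
split=> [/eqP | twins].
  rewrite c4_homs_leqif => /'forall_forallP h x y z xz yz; apply/eqP.
  rewrite -codeg_eq_r; have /orP[|//] := h x y.
  by rewrite eqn0Ngt => /codeg_gt0P[]; exists z.
apply/eqP; rewrite c4_homs_leqif; apply/'forall_forallP => x y.
rewrite codeg_eq_r eqn0Ngt; case: codeg_gt0P => //= -[z xz yz].
by apply/eqP; apply: twins xz yz.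
Qed.

Section Structure.
Context (r_gt0 : (0 < r)%N) (G_tf : triangle_free G).
Context (twins : twins_if_common_nbr).

(** The default value is never reached, since degrees are positive. *)
Definition some_nbr x := odflt x [pick y | edge x y].

Lemma edge_some_nbr x : edge x (some_nbr x).
Proof.
rewrite /some_nbr; case: pickP => //= noedge.
have : (0 < #|nbhd x|)%N by rewrite (card_nbhd G_reg).
by case/card_gt0P => y; rewrite inE noedge.
Qed.

(** By [nbhd_nbr] every neighbour of [x] has the neighbourhood of
    [some_nbr x], so these two sets are the sides of a complete bipartite graph
    with no edge leaving it: the connected component of [x]. *)
Definition component x := nbhd x :|: nbhd (some_nbr x).

Lemma nbhd_nbr x y : edge x y -> nbhd y = nbhd (some_nbr x).
Proof. by move=> xy; apply: (twins (z := x)); rewrite edge_sym // edge_some_nbr. Qed.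

(** A vertex on the side of [x] keeps both sides, one on the other side
    exchanges them. *)
Lemma component_eq x z : z \in component x -> component z = component x.
Proof.
rewrite /component !inE => /orP[xz | xz].
  rewrite (nbhd_nbr xz) setUC; congr (_ :|: _).
  by apply: (twins (z := z)); rewrite // edge_sym edge_some_nbr.
have nz : nbhd z = nbhd x.
  by apply: (twins (z := some_nbr x)); rewrite ?edge_some_nbr // edge_sym.
rewrite nz; congr (_ :|: _); apply: nbhd_nbr.
by have := edge_some_nbr z; rewrite -!(in_set (edge _)) -/(nbhd _) nz.
Qed.

Lemma mem_component x : x \in component x.
Proof. by rewrite !inE (edge_sym _ x) edge_some_nbr orbT. Qed.

Lemma nbhd_nbr_disjoint x z : edge x z -> edge (some_nbr x) z -> False.
Proof.
move=> xz nz; have := G_tf x (some_nbr x) z.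
by rewrite edge_some_nbr xz nz.
Qed.

(** The choice depends on the set [component x] only, so it is the same for all
    vertices of a component ([rep_eq]). *)
Definition rep x := odflt x [pick z in component x].

Lemma rep_in x : rep x \in component x.
Proof. by rewrite /rep; case: pickP => //= /(_ x); rewrite mem_component. Qed.

Lemma rep_eq x y : component x = component y -> rep x = rep y.
Proof.
rewrite /rep => ->; case: pickP => //= /(_ y); by rewrite mem_component.
Qed.

Definition reps : {set G} := rep @: [set: G].

Lemma rep_reps u : u \in reps -> rep u = u.
Proof. by case/imsetP => v _ ->; apply/rep_eq/component_eq/rep_in. Qed.

(** The left copy of ['I_r] is sent to the side of the component not
    containing its representative [u]. *)
Definition side u (b : 'I_r + 'I_r) : {set G} :=
  if b is inl _ then nbhd u else nbhd (some_nbr u).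
Definition position (b : 'I_r + 'I_r) : nat :=
  match b with inl j => j | inr j => j end.

(** The isomorphism, built in the direction from the disjoint union of complete
    bipartite graphs to [G], in which no cardinality has to be known in advance
    to index the components: the number of copies is the number of
    representatives. *)
Definition blowup (p : 'I_#|reps| * ('I_r + 'I_r)) : G :=
  let u := enum_val p.1 in nth u (enum (side u p.2)) (position p.2).

Lemma card_side u b : #|side u b| = r.
Proof. by case: b => j; rewrite (card_nbhd G_reg). Qed.

Lemma position_lt b : (position b < r)%N.
Proof. by case: b => j /=. Qed.

Lemma blowup_side p : blowup p \in side (enum_val p.1) p.2.
Proof. by rewrite -mem_enum mem_nth // -cardE card_side position_lt. Qed.

Lemma blowup_component p : blowup p \in component (enum_val p.1).
Proof.
have := blowup_side p; rewrite /component inE.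
by case: p.2 => j /= ->; rewrite ?orbT.
Qed.

Lemma blowup_index p q :
  component (blowup p) = component (blowup q) -> p.1 = q.1.
Proof.
rewrite !(component_eq (blowup_component _)) => /rep_eq.
by rewrite !rep_reps ?enum_valP // => /enum_val_inj.
Qed.

(** Adjacent images lie in one component. Within it, vertices on opposite sides
    are adjacent, and an edge inside a side would put a vertex on both sides,
    forming a triangle. *)
Lemma edge_blowup p q :
  edge (blowup p) (blowup q) = (p.1 == q.1) && complete_bip_edge p.2 q.2.
Proof.
case: eqVneq => [pq | npq] /=; last first.
  apply: contraNF npq => e; apply/eqP/blowup_index/esym/component_eq.
  by rewrite !inE e.
have := blowup_side p; have := blowup_side q; rewrite -pq.
set u := enum_val _; set x := blowup p; set y := blowup q.
have nL z : z \in nbhd u -> nbhd z = nbhd (some_nbr u).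
  by rewrite inE => /nbhd_nbr.
have nR z : z \in nbhd (some_nbr u) -> nbhd z = nbhd u.
  rewrite inE => uz; apply: (twins (z := some_nbr u)); last exact: edge_some_nbr.
  by rewrite edge_sym.
have eE : edge x y = (y \in nbhd x) by rewrite inE.
rewrite eE; case: p.2 => i; case: q.2 => j /= yS xS;
  rewrite ?(nL _ xS) ?(nR _ xS) //; apply/negP => yS';
  move: yS yS'; rewrite !inE => h1 h2;
  [exact: (nbhd_nbr_disjoint h1 h2)|exact: (nbhd_nbr_disjoint h2 h1)].
Qed.

Lemma blowup_inj : injective blowup.
Proof.
move=> p q e; have i_eq : p.1 = q.1 by apply: blowup_index; rewrite e.
have := blowup_side p; have := blowup_side q; move: e.
case: p q i_eq => i b [j c] /= <-; rewrite /blowup /=.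
set u := enum_val i.
have nth_eq (A : {set G}) (k l : 'I_r) : #|A| = r ->
    nth u (enum A) k = nth u (enum A) l -> k = l.
  move=> cA /eqP; rewrite nth_uniq ?enum_uniq -?cardE ?cA // => /eqP.
  exact: val_inj.
case: b c => k [] l /= e h1 h2.
- by rewrite (nth_eq _ _ _ (card_nbhd G_reg u) e).
- by rewrite -e !inE in h1 h2; case: (nbhd_nbr_disjoint h2 h1).
- by rewrite -e !inE in h1 h2; case: (nbhd_nbr_disjoint h1 h2).
- by rewrite (nth_eq _ _ _ (card_nbhd G_reg _) e).
Qed.

Lemma blowup_surj v : exists p, blowup p = v.
Proof.
have uX : rep v \in reps by apply: imset_f; rewrite inE.
pose i := enum_rank_in uX (rep v).
have iE : enum_val i = rep v by rewrite enum_rankK_in.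
have nthP (A : {set G}) : #|A| = r -> v \in A ->
    exists j : 'I_r, nth (rep v) (enum A) j = v.
  move=> cA vA; have lt_r : (index v (enum A) < r)%N.
    by rewrite -cA cardE index_mem mem_enum.
  by exists (Ordinal lt_r); rewrite /= nth_index ?mem_enum.
have := mem_component v; rewrite -(component_eq (rep_in v)) inE.
case/orP => /(nthP _ (card_nbhd G_reg _))[j jE].
  by exists (i, inl j); rewrite /blowup /= iE.
by exists (i, inr j); rewrite /blowup /= iE.
Qed.

Lemma blowup_bij : bijective blowup.
Proof.
apply: (inj_card_bij blowup_inj).
rewrite -cardsT -(card_codom blowup_inj) subset_leq_card //.
apply/subsetP => v _; have [p <-] := blowup_surj v; exact: codom_f.
Qed.

(** The divisibility of [n] by [2 r] comes out of the bijection. *)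
Lemma graph_iso_copies_of_twins :
  #|G| = (#|reps| * (2 * r))%N /\ graph_iso G (copies #|reps| (complete_bip r)).
Proof.
have [f blowupK fK] := blowup_bij; split.
  have := bij_eq_card blowup_bij.
  by rewrite card_prod card_sum !card_ord addnn mul2n => <-.
exists f; first by exists blowup.
by move=> x y; rewrite -{2}(fK x) -{2}(fK y) edge_blowup.
Qed.

End Structure.
End Regular.

Lemma twins_of_graph_iso k r :
  graph_iso G (copies k (complete_bip r)) -> twins_if_common_nbr.
Proof.
case=> f _ fE x y z; rewrite -!fE => xz yz; apply/setP => w; rewrite !inE -!fE.
move: (f x) (f y) (f z) (f w) xz yz => [i [] a] [j [] b] [l [] c] [m [] d];
  rewrite /edge /= /copies_edge /= ?andbF // !andbT => /eqP-> /eqP->; by rewrite ?andbF.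
Qed.

End Extremal.

(** * Comparison with the Taylor coefficients *)

Lemma natr_ffactS (K : pzRingType) (r k : nat) :
  (r ^_ k.+1)%:R = (r ^_ k)%:R * (r%:R - k%:R) :> K.
Proof.
rewrite ffactnSr natrM; case: (leqP k r) => [kr | rk]; first by rewrite natrB.
by rewrite ffact_small // !mul0r.
Qed.

(** [c3] is [6 i_3] for a triangle-free graph, and the last formula is
    [num_indep4_regular] with [c4_homs] replaced by its maximum [n r^3]. *)
Lemma taylor_coef_extremal (R : realType) (n r : nat) : (1 <= r)%N ->
  let P := fun x : R => (2 * (1 + x) ^+ r - 1) `^ (n%:R / (2 * r%:R)) in
  let N : R := n%:R in
  let rr : R := r%:R in
  let c3 := N * (N - rr - 1) * (N - 2 * (rr + 1)) + N * (rr * (rr - 1)) in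
  [/\ taylor_coef 0 P = 1, taylor_coef 1 P = N,
      taylor_coef 2 P * 2 = N * (N - rr - 1),
      taylor_coef 3 P * 6 = c3 &
      taylor_coef 4 P * 24 =
        (N - 3 * (rr + 1)) * c3
        + 3 * ((N - 2 * (rr + 1)) * (N * (rr * (rr - 1)))
               + N * rr ^+ 3 - N * rr ^+ 2)
        - N * (rr * (rr - 1)) * (rr - 2)].
Proof.
move=> r_gt0 P N rr c3; rewrite /c3.
have rr_neq0 : rr != 0 by rewrite pnatr_eq0 -lt0n.
have tE t : taylor_coef t P * t`!%:R =
    (pow_deriv_num (N / (2 * rr)) (base_poly r) t).[0].
  exact: taylor_coef_base_powR.
have b0 : (base_poly r).[0] = 1 :> R.
  by rewrite /base_poly !hornerE expr1n; ring.
have [d1 d2 d3 d4] := pow_deriv_num4 (N / (2 * rr)) b0.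
move: (tE 0%N) (tE 1%N) (tE 2%N) (tE 3%N) (tE 4%N).
rewrite d1 d2 d3 d4 !base_poly_derivn0 !natr_ffactS ffactn0 /= hornerC -/rr.
rewrite !mulr1 => -> -> e2 e3 e4.
split; [by [] | by field | rewrite [LHS]e2 | rewrite [LHS]e3 | rewrite [LHS]e4];
  by field.
Qed.

Theorem theorem1p9 (R : realType) (n r : nat) (G : sgraph)
    (hr : (1 <= r)%N) (hn : #|G| = n) (hreg : regular_graph r G) :
  let P := fun x : R => (2 * (1 + x) ^+ r - 1) `^ (n%:R / (2 * r%:R)) in
  (forall t : nat, (t <= 3)%N -> (num_indep t G)%:R <= taylor_coef t P) /\
  (triangle_free G ->
     (num_indep 4 G)%:R <= taylor_coef 4 P /\
     ((num_indep 4 G)%:R = taylor_coef 4 P <->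
        (2 * r %| n)%N /\
        graph_iso G (copies (n %/ (2 * r)) (complete_bip r)))).
Proof.
move=> P; have [c0 c1 c2 c3 c4] := @taylor_coef_extremal R n r hr.
rewrite -/P in c0 c1 c2 c3 c4.
have i2 := num_indep2_regular (K := R) hreg.
have i3 := num_indep3_regular (K := R) hreg.
have D_le := apart_codeg_le (K := R) hreg.
rewrite !hn in i2 i3 D_le.
split.
  case=> [|[|[|[|//]]]] _.
  - by rewrite c0 num_indep0.
  - by rewrite c1 num_indep1 hn.
  - by rewrite -(@ler_pM2r _ 2)// c2 -i2 mulrC.
  - by rewrite -(@ler_pM2r _ 6)// c3 mulrC i3 lerD2l.
move=> G_tf.
have i4 := num_indep4_regular (K := R) hreg G_tf.
rewrite i3 (apart_codeg_tf hreg G_tf) hn in i4.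
(* The whole deficit is that of the number of 4-cycle homomorphisms. *)
have gap : (taylor_coef 4 P - (num_indep 4 G)%:R) * 24 =
    3 * ((n * r ^ 3)%:R - (c4_homs (G := G))%:R).
  by rewrite mulrBl c4 (mulrC (num_indep 4 G)%:R) i4 natrM natrX; ring.
have hom_le : (c4_homs (G := G) <= n * r ^ 3)%N by rewrite -hn (c4_homs_leqif hreg).
split.
  rewrite -subr_ge0 -(@pmulr_lge0 _ 24)// gap.
  by rewrite mulr_ge0// subr_ge0 ler_nat.
have eqE : (num_indep 4 G)%:R = taylor_coef 4 P <-> twins_if_common_nbr (G := G).
  rewrite -(c4_homs_maxP hreg) hn; split=> [e | e].
    move: gap; rewrite e subrr mul0r => /esym/eqP.
    by rewrite mulf_eq0 pnatr_eq0 subr_eq0 eqr_nat => /eqP ->.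
  move: gap; rewrite e subrr mulr0 => /eqP.
  by rewrite mulf_eq0 (pnatr_eq0 _ 24) orbF subr_eq0 => /eqP ->.
rewrite eqE; split=> [twins | [_ /twins_of_graph_iso //]].
have [] := graph_iso_copies_of_twins hreg hr G_tf twins.
rewrite hn => -> iso; rewrite dvdn_mull // mulnK // muln_gt0; exact: hr.
Qed.
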